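(* Suppose every choice function ${\cal C}^r$, $r \in T'$, is anti-monotone. Then the Decomposition Algorithm described in the context converges in finitely many iterations; that is, after finitely many iterations of its main loop the stopping condition $UB \le LB + \epsilon$ is satisfied.
   Context: Data. A finite set $N$ of stops, a set $H \subseteq N$ of hubs, a finite set $T$ of trips, a subset $T' \subseteq T$ of trips whose riders choose whether to adopt the transit system. Each $r \in T$ has an origin $or^r \in N$, a destination $de^r \in N$, and a number of passengers $p^r \in \mathbb{Z}_+$. For $i,j \in N$, $d_{ij} \ge 0$ and $t_{ij} \ge 0$ are the distance and time from $i$ to $j$ (possibly asymmetric, satisfying the triangle inequality). Let $\theta \in [0,1]$, $S \ge 0$ (average bus waiting time), $g \ge 0$ (shuttle cost per mile), $b \ge 0$ (bus cost per mile), $n \ge 0$ (number of buses), $\Delta \ge 0$ (distance threshold), $M > 0$ (large constant). Define $\beta_{hl} = (1-\theta)\, b\, n\, d_{hl}$ and $\tau^r_{hl} = \theta(t_{hl}+S)$ for $h,l\in H$, and $\gamma^r_{ij} = (1-\theta)\frac{g}{2} d_{ij} + \theta t_{ij}$ if $d_{ij}\le\Delta$, $\gamma^r_{ij} = M$ if $d_{ij}>\Delta$. Each $r\in T'$ has a choice function ${\cal C}^r:\mathbb{R}\to\{0,1\}$; it is anti-monotone if $d_1 \le d_2$ implies ${\cal C}^r(d_1)\ge{\cal C}^r(d_2)$. Let $A^r = \{(or^r,h): h \in H\} \cup \{(h,de^r): h\in H\} \cup \{(or^r,de^r)\}$. Follower problem. For $\bar z \in \{0,1\}^{H\times H}$,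 $SP^r(\bar z)$ is the optimal value of $$\min \sum_{h,l \in H} \tau^r_{hl} x^r_{hl} + \sum_{(i,j) \in A^r} \gamma^r_{ij} y^r_{ij}$$ subject to flow conservation at each $i \in N$ (total outgoing minus incoming flow of $x^r$ and $y^r$ at $i$ equals $1$ if $i = or^r$, $-1$ if $i = de^r$, $0$ otherwise), $x^r_{hl} \le \bar z_{hl}$ for all $h,l\in H$, and $x^r_{hl}, y^r_{ij} \in \{0,1\}$. Since integrality can be relaxed, $SP^r(\bar z)$ is also the optimal value of the dual subproblem $$\max\ (u^r_{or^r}-u^r_{de^r}) - \sum_{h,l\in H}\bar z_{hl}v^r_{hl}$$ subject to $u^r_h-u^r_l-v^r_{hl}\le\tau^r_{hl}$ for all $h,l\in H$; $u^r_i-u^r_j\le\gamma^r_{ij}$ for all $(i,j)\in A^r$; $u^r_i\ge0$ for all $i\in N$; $v^r_{hl}\ge0$ for all $h,l\in H$. Bilevel problem being solved: minimize $\sum_{h,l}\beta_{hl}z_{hl}+\sum_{r\in T\setminus T'}p^r d^r+\sum_{r\in T'}p^r\delta^r d^r$ over $z\in\{0,1\}^{H\times H}$ with $\sum_{l}z_{hl}=\sum_{l}z_{lh}$ for all $h\in H$, where $d^r=SP^r(z)$ for $r\in T$ and $\delta^r={\cal C}^r(d^r)$ for $r\in T'$. Initial relaxed master problem: minimize $$\sum_{h,l\in H}\beta_{hl}z_{hl}+\sum_{r\in T\setminus T'}p^rd^r+\sum_{r\in T'}p^r\nu^r$$ over $z_{hl}\in\{0,1\}$ ($h,l\in H$),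 $\delta^r\in\{0,1\}$ and $\nu^r$ ($r\in T'$), and $d^r\ge0$ ($r\in T$), subject to $\sum_{l\in H}z_{hl}=\sum_{l\in H}z_{lh}$ for all $h\in H$, and, for all $r\in T'$, $\nu^r\le\bar M^r\delta^r$, $\nu^r\le d^r$, $\nu^r\ge d^r-\bar M^r(1-\delta^r)$, $\nu^r\ge0$, where $\bar M^r$ is a constant with $\bar M^r\ge SP^r(z)$ for every $z\in\{0,1\}^{H\times H}$ (so $\nu^r$ linearizes $\delta^r d^r$). Decomposition Algorithm, with tolerance $\epsilon\ge0$. Initialize $LB=-\infty$, $UB=+\infty$, $z^*=\emptyset$. While $UB>LB+\epsilon$: 1. Solve the current relaxed master problem to optimality, obtaining $(\bar z,\bar\delta,\bar d)$; set $LB$ to its optimal value. 2. For every $r\in T$: solve the dual subproblem under $\bar z$, obtaining $SP^r(\bar z)$ and an optimal vertex $(\bar u^r,\bar v^r)$; add to the master problem the optimality cut $d^r\ge(\bar u^r_{or^r}-\bar u^r_{de^r})-\sum_{h,l\in H}z_{hl}\bar v^r_{hl}$. 3. For every $r\in T'$: if $\bar\delta^r=1$ and ${\cal C}^r(SP^r(\bar z))=0$, add the cut $\sum_{(h,l):\bar z_{hl}=0}z_{hl}\ge\delta^r$; if $\bar\delta^r=0$ and ${\cal C}^r(SP^r(\bar z))=1$, add the cut $\sum_{(h,l):\bar z_{hl}=1}(1-z_{hl})+\delta^r\ge1$. Set $\hat\delta^r={\cal C}^r(SP^r(\bar z))$. 4. Let $\widehat{UB}=\sum_{h,l}\beta_{hl}\bar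 z_{hl}+\sum_{r\in T\setminus T'}p^rSP^r(\bar z)+\sum_{r\in T'}p^r\hat\delta^rSP^r(\bar z)$. If $\widehat{UB}<UB$, set $UB=\widehat{UB}$ and $z^*=\bar z$. *)

(* Defs.v *)
From HB Require Import structures.
From mathcomp Require Import all_boot all_order all_algebra.
From mathcomp Require Import boolp classical_sets reals constructive_ereal.

Set Implicit Arguments.
Unset Strict Implicit.
Unset Printing Implicit Defensive.

Import Order.TTheory GRing.Theory Num.Theory.

Local Open Scope classical_set_scope.
Local Open Scope ring_scope.

Record transit (R : realType) := Transit {
  stop : finType;
  hubs : {set stop};
  trip : finType;
  choosers : {set trip};       (* riders choose whether to adopt transit *)
  orig : trip -> stop;
  dest : trip -> stop;
  pax : trip -> nat;           (* number of passengers *)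
  dist : stop -> stop -> R;
  time : stop -> stop -> R;
  theta : R;
  wait : R;                    (* average bus waiting time *)
  shuttle_cost : R;            (* per mile *)
  bus_cost : R;                (* per mile *)
  nbuses : R;
  threshold : R;
  bigM : R;
  dist_ge0 : forall i j, 0 <= dist i j;
  time_ge0 : forall i j, 0 <= time i j;
  dist_triangle : forall i j k, dist i k <= dist i j + dist j k;
  time_triangle : forall i j k, time i k <= time i j + time j k;
  theta_01 : 0 <= theta <= 1;
  wait_ge0 : 0 <= wait;
  shuttle_cost_ge0 : 0 <= shuttle_cost;
  bus_cost_ge0 : 0 <= bus_cost;
  nbuses_ge0 : 0 <= nbuses;
  threshold_ge0 : 0 <= threshold;
  bigM_gt0 : 0 < bigM }.

Definition anti_monotone (R : realType) (f : R -> bool) : Prop :=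
  forall d1 d2 : R, d1 <= d2 -> (f d2 <= f d1)%N.

Definition extreme_point (R : realType) (V : lmodType R) (P : set V) (x : V) :
    Prop :=
  P x /\
  forall (a b : V) (t : R), P a -> P b -> 0 < t < 1 ->
    x = t *: a + (1 - t) *: b -> a = b.

Section Model.
Variables (R : realType) (I : transit R).

Definition hub : finType := {h : stop I | h \in hubs I}.
Definition link : finType := (hub * hub)%type.
Definition chooser : finType := {r : trip I | r \in choosers I}.

(* An element of {0,1}^(H x H). *)
Definition design : finType := {ffun link -> bool}.

Definition beta (a : link) : R :=
  (1 - theta I) * bus_cost I * nbuses I * dist (val a.1) (val a.2).

(* tau and gamma take the same value for every trip. *)
Definition tau (a : link) : R := theta I * (time (val a.1) (val a.2) + wait I).

Definition gamma (i j : stop I) : R :=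
  if dist i j <= threshold I
  then (1 - theta I) * (shuttle_cost I / 2) * dist i j + theta I * time i j
  else bigM I.

Definition arcs (r : trip I) : {set stop I * stop I} :=
  [set (orig r, h) | h in hubs I] :|: [set (h, dest r) | h in hubs I]
    :|: [set (orig r, dest r)]%SET.

Definition arc (r : trip I) : finType := {a : stop I * stop I | a \in arcs r}.

Definition flow (r : trip I) : Type :=
  ({ffun link -> bool} * {ffun arc r -> bool})%type.

Definition net_outflow (r : trip I) (f : flow r) (i : stop I) : R :=
  (\sum_(a : link | val a.1 == i) (f.1 a)%:R
     + \sum_(a : arc r | (val a).1 == i) (f.2 a)%:R)
  - (\sum_(a : link | val a.2 == i) (f.1 a)%:R
     + \sum_(a : arc r | (val a).2 == i) (f.2 a)%:R).

(* The supply is 1 at the origin, -1 at the destination and 0 elsewhere; it is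
   0 everywhere for a trip whose origin and destination coincide. *)
Definition follower_feasible (r : trip I) (z : design) (f : flow r) : Prop :=
  (forall i : stop I,
     net_outflow f i = (i == orig r)%:R - (i == dest r)%:R) /\
  (forall a : link, (f.1 a <= z a)%N).

Definition follower_cost (r : trip I) (f : flow r) : R :=
  \sum_(a : link) tau a * (f.1 a)%:R
  + \sum_(a : arc r) gamma (val a).1 (val a).2 * (f.2 a)%:R.

(* The infimum is a minimum: there are finitely many flows, and sending the
   rider directly from origin to destination is always feasible. *)
Definition SP (r : trip I) (z : design) : R :=
  inf [set follower_cost f | f in follower_feasible (r := r) z].

(* Pairs (u, v), with u indexed by stops and v by pairs of hubs. *)
Definition dual_point : lmodType R :=
  ({ffun stop I -> R^o} * {ffun link -> R^o})%type.

Definition dual_feasible (r : trip I) : set dual_point :=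
  [set w : dual_point | [/\ forall a : link,
                 w.1 (val a.1) - w.1 (val a.2) - w.2 a <= tau a,
               forall i j : stop I, (i, j) \in arcs r ->
                 w.1 i - w.1 j <= gamma i j,
               forall i : stop I, 0 <= w.1 i
             & forall a : link, 0 <= w.2 a]].

Definition dual_objective (r : trip I) (z : design) (w : dual_point) : R :=
  (w.1 (orig r) - w.1 (dest r)) - \sum_(a : link) (z a)%:R * w.2 a.

Definition dual_optimal_vertex (r : trip I) (z : design) (w : dual_point) :
    Prop :=
  extreme_point (dual_feasible r) w /\
  forall w', dual_feasible r w' -> dual_objective r z w' <= dual_objective r z w.

Record master_point := MasterPoint {
  mz : design;
  mdelta : {ffun chooser -> bool};
  mnu : chooser -> R;
  md : trip I -> R }.

Definition master_objective (q : master_point) : R :=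
  \sum_(a : link) beta a * (mz q a)%:R
  + \sum_(r : trip I | r \notin choosers I) (pax r)%:R * md q r
  + \sum_(r : chooser) (pax (val r))%:R * mnu q r.

Definition initial_master (Mbar : chooser -> R) : set master_point :=
  [set q | [/\ forall h : hub,
                 (\sum_(l : hub) mz q (h, l) = \sum_(l : hub) mz q (l, h))%N,
               forall r : trip I, 0 <= md q r
             & forall r : chooser,
                 [/\ mnu q r <= Mbar r * (mdelta q r)%:R,
                     mnu q r <= md q (val r),
                     md q (val r) - Mbar r * (1 - (mdelta q r)%:R) <= mnu q r
                   & 0 <= mnu q r]]].

Definition master_optimal (F : set master_point) (q : master_point) : Prop :=
  F q /\ forall q', F q' -> master_objective q <= master_objective q'.

Definition optimality_cut (r : trip I) (w : dual_point) : set master_point :=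
  [set q | dual_objective r (mz q) w <= md q r].

Definition rejection_cut (r : chooser) (zbar : design) : set master_point :=
  [set q | (mdelta q r)%:R <= \sum_(a : link | ~~ zbar a) (mz q a)%:R :> R].

Definition adoption_cut (r : chooser) (zbar : design) : set master_point :=
  [set q | 1 <= \sum_(a : link | zbar a) (1 - (mz q a)%:R)
                + (mdelta q r)%:R :> R].

Section Algorithm.
Variables (C : chooser -> R -> bool) (Mbar : chooser -> R) (eps : R).

(* Points satisfying the choice cut (if any) generated for r at an optimal
   solution qbar of the current master problem. *)
Definition choice_cut (qbar : master_point) (r : chooser) : set master_point :=
  match mdelta qbar r, C r (SP (val r) (mz qbar)) with
  | true, false => rejection_cut r (mz qbar)
  | false, true => adoption_cut r (mz qbar)
  | _, _ => setT
  end.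

Definition UBhat (z : design) : R :=
  \sum_(a : link) beta a * (z a)%:R
  + \sum_(r : trip I | r \notin choosers I) (pax r)%:R * SP r z
  + \sum_(r : chooser)
      (pax (val r))%:R * (C r (SP (val r) z))%:R * SP (val r) z.

(* The current relaxed master problem is given by its feasible set; its
   objective never changes. *)
Record state := State {
  LB : \bar R;
  UB : \bar R;
  incumbent : option design;
  master : set master_point }.

Definition init_state : state := State -oo%E +oo%E None (initial_master Mbar).

Definition stopped (s : state) : bool := (UB s <= LB s + eps%:E)%E.

(* One pass through the loop body. It is a relation, since any optimal solution
   of the master problem and any optimal dual vertices may be returned. *)
Definition iteration (s s' : state) : Prop :=
  exists (q : master_point) (w : trip I -> dual_point),
    [/\ master_optimal (master s) q,
        forall r : trip I, dual_optimal_vertex r (mz q) (w r)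
      & s' = State
          (master_objective q)%:E
          (if ((UBhat (mz q))%:E < UB s)%E then (UBhat (mz q))%:E else UB s)
          (if ((UBhat (mz q))%:E < UB s)%E then Some (mz q) else incumbent s)
          (master s
             `&` [set q' | forall r : trip I, optimality_cut r (w r) q']
             `&` [set q' | forall r : chooser, choice_cut q r q'])].

Inductive reachable : state -> Prop :=
| reachable_init : reachable init_state
| reachable_iter (s s' : state) :
    reachable s -> ~~ stopped s -> iteration s s' -> reachable s'.

(* s k is the state after k iterations; the states that follow the first
   stopped one are irrelevant and left unconstrained. *)
Definition execution (s : nat -> state) : Prop :=
  s 0%N = init_state /\
  forall k : nat, ~~ stopped (s k) -> iteration (s k) (s k.+1).

End Algorithm.
End Model.

(* Main.v *)
Require Import Defs.
From mathcomp Require Import all_boot all_order all_algebra.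
From mathcomp Require Import boolp classical_sets reals constructive_ereal.
From mathcomp Require Import ring lra.

(** Termination is a pigeonhole argument. A pair (z, delta) of a design and a
    choice vector ranges over a finite set, so in an infinite run some pair is
    returned twice by the master problem, say at iterations i < j. The cuts of
    iteration i hold at the second return. The choice cuts exclude every point
    that has the same pair when delta is not the choice made at z, so delta is
    that choice ([choice_cut_exact]). The optimality cuts bound each d from
    below by the dual optimum at z, which is SP by strong duality
    ([dual_optimal_value]). Hence the master value of iteration j, which is the
    new LB, is at least UBhat z ([UBhat_le_objective]), while UB is at most
    UBhat z since iteration i: the stopping test succeeds after iteration j.

    That no run blocks requires optima of both problems. For the dual
    subproblem, weak duality gives a bound and shortest-path distances from the
    origin give a dual solution reaching it ([strong_duality]); an LP over a
    polyhedron without lines that has an optimum also has an optimal vertex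
    ([optimal_extreme_point]). For the master problem, fixing (z, delta) leaves
    only lower bounds on d, so each of the finitely many fibers has a best point
    ([master_optimum_exists]). The master stays feasible because no cut removes
    a point of the bilevel problem: optimality cuts by weak duality, and choice
    cuts because opening more links cannot increase SP, while an anti-monotone
    choice function cannot turn an adopter away when SP decreases
    ([bilevel_point_choice_cut]). *)

Set Implicit Arguments.
Unset Strict Implicit.
Unset Printing Implicit Defensive.

Import Order.TTheory GRing.Theory Num.Theory.

Local Open Scope ring_scope.

(** * Optimal vertices of linear programs *)

Definition polyhedron (R : realType) (V : lmodType R) (K : finType)
    (l : K -> V -> R) (c : K -> R) : set V :=
  [set x | forall k, l k x <= c k]%classic.

(** Moving from [x] along [e] preserves the tight constraints, and some
    constraint limits the move; the ratio test finds the first one reached. *)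
Lemma exists_new_tight (R : realType) (V : lmodType R) (K : finType)
    (l : K -> V -> R) (c : K -> R) (x e : V) :
  (forall k, scalar (l k)) -> polyhedron l c x ->
  (forall k, l k x = c k -> l k e = 0) -> (exists k, 0 < l k e) ->
  exists s : R, polyhedron l c (x + s *: e) /\
    exists k, l k x <> c k /\ l k (x + s *: e) = c k.
Proof.
move=> lin Px tight [k0 k0_gt0].
have lE k s : l k (x + s *: e) = l k x + s * l k e by rewrite addrC lin addrC.
pose ratio k := (c k - l k x) / l k e.
have [k k_gt0 k_min] := arg_minP (P := [pred k | 0 < l k e]) ratio k0_gt0.
have ratioK j : 0 < l j e -> ratio j * l j e = c j - l j x.
  by move=> j_gt0; rewrite divfK ?gt_eqF.
exists (ratio k); split; last first.
  exists k; split; last by rewrite lE ratioK //; ring.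
  by move=> /tight ke0; move: k_gt0; rewrite /= ke0 ltxx.
move=> j; rewrite lE.
have [j_gt0|j_le0] := ltP 0 (l j e).
  have := k_min j j_gt0; rewrite -(ler_pM2r j_gt0) ratioK //; lra.
have ratio_ge0 : 0 <= ratio k by rewrite divr_ge0 ?subr_ge0 ?Px // ltW.
have := Px j; have := mulr_ge0_le0 ratio_ge0 j_le0; lra.
Qed.

(** The functionals [l] separate points, so the polyhedron contains no line. An
    optimal point with as many tight constraints as possible is extreme: if it
    were strictly between feasible [a] and [b], then [a - b] would keep the
    objective and all tight constraints unchanged, and moving along it would
    make one more constraint tight. *)
Lemma optimal_extreme_point (R : realType) (V : lmodType R) (K : finType)
    (l : K -> V -> R) (c : K -> R) (obj : V -> R) (x0 : V) :
  (forall k, scalar (l k)) -> scalar obj ->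
  (forall e, (forall k, l k e = 0) -> e = 0) ->
  polyhedron l c x0 -> (forall y, polyhedron l c y -> obj y <= obj x0) ->
  exists x, extreme_point (polyhedron l c) x /\
    forall y, polyhedron l c y -> obj y <= obj x.
Proof.
move=> lin objlin pointed Px0 x0max.
have scalarZ (f : V -> R) : scalar f -> forall a u, f (a *: u) = a * f u.
  move=> flin a u; have f0 : f 0 = 0.
    by have := flin (-1) 0 0; rewrite scaler0 addr0 mulN1r addNr.
  by rewrite -[a *: u]addr0 flin f0 addr0.
pose optimal x := polyhedron l c x /\ obj x = obj x0.
pose tight x := [set k | l k x == c k].
pose P n := `[< exists2 x, optimal x & #|tight x| = n >].
have P_ex : exists n, P n by exists #|tight x0|; apply/asboolP; exists x0.
have P_le n : P n -> (n <= #|K|)%N by move=> /asboolP[x _ <-]; exact: max_card.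
case: (ex_maxnP P_ex P_le) => n /asboolP[x [Px objx] <-] xmax.
exists x; split=> [|y /x0max]; last by rewrite objx.
split=> // a b t Pa Pb /andP[t0 t1] xE.
apply: contrapT => ab.
have combE (f : V -> R) : scalar f -> f x = t * f a + (1 - t) * f b.
  by move=> flin; rewrite xE flin scalarZ.
have diffE (f : V -> R) : scalar f -> f (a - b) = f a - f b.
  by move=> flin; rewrite -scaleN1r addrC flin; ring.
(* A weighted mean of two numbers below a bound attains it only if both do. *)
have both (u v m : R) :
    u <= m -> v <= m -> m = t * u + (1 - t) * v -> u - v = 0.
  by move=> um vm mE; nra.
have tight0 k : l k x = c k -> l k (a - b) = 0.
  move=> xk; rewrite diffE //; apply: (both _ _ (c k)); [exact: Pa|exact: Pb|].
  by rewrite -xk combE.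
have obj0 : obj (a - b) = 0.
  rewrite diffE //; apply: (both _ _ (obj x0)); [exact: x0max|exact: x0max|].
  by rewrite -objx combE.
have [k kne0] : exists k, l k (a - b) != 0.
  apply: contrapT => noex; apply: ab; apply/eqP; rewrite -subr_eq0; apply/eqP.
  by apply: pointed => k; apply: contrapT => /eqP kne0; apply: noex; exists k.
(* The sign makes some constraint functional increase along [e]. *)
pose e := Num.sg (l k (a - b)) *: (a - b).
have [||s [Pxs [j [jx jxs]]]] := @exists_new_tight _ _ _ l c x e lin Px.
- by move=> j xj; rewrite (scalarZ (l j)) // (tight0 _ xj) mulr0.
- by exists k; rewrite (scalarZ (l k)) // -normrEsg normr_gt0.
have oxs : optimal (x + s *: e).
  by split=> //; rewrite addrC objlin (scalarZ obj) // obj0 objx; ring.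
have : (#|tight (x + s *: e)%R| <= #|tight x|)%N.
  by apply: xmax; apply/asboolP; exists (x + s *: e).
rewrite leqNgt => /negP[]; apply: proper_card; apply/properP; split.
  apply/fintype.subsetP => i; rewrite !inE => /eqP xi.
  by rewrite addrC lin (scalarZ (l i)) // (tight0 _ xi) !mulr0 add0r xi.
by exists j; rewrite !inE; [rewrite jxs|exact/eqP].
Qed.

(** * Shortest trails in a directed multigraph *)

Section Trails.
Variables (R : realDomainType) (N E : finType) (src tgt : E -> N).
Variables (cost : E -> R).
Variables (avail : pred E) (s : N).

Fixpoint walk (i : N) (p : seq E) (j : N) : bool :=
  if p is e :: p' then (src e == i) && walk (tgt e) p' j else i == j.

(** A trail may repeat nodes but not edges. This is all that is needed for its
    edge set to be a 0/1 flow, and it makes minimal costs range over the finite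
    type of edge sets. *)
Definition trail_to (j : N) (A : {set E}) : Prop :=
  exists p, [/\ uniq p, all avail p, walk s p j & A = [set e in p]].

Lemma walk_rcons i p e : walk i (rcons p e) (tgt e) = walk i p (src e).
Proof.
by elim: p i => [|e' p IHp] i /=; rewrite ?eqxx ?andbT 1?eq_sym // IHp.
Qed.

Lemma walk_cat i p q j : walk i (p ++ q) j ->
  exists2 k, walk i p k & walk k q j.
Proof.
elim: p i => [|e p IHp] i /=; first by move=> wq; exists i.
by case/andP=> -> /IHp.
Qed.

(** The edge set of a trail is a unit flow: along the walk the divergences
    telescope, and no edge is counted twice. *)
Lemma trail_divergence j A : trail_to j A -> forall k,
  \sum_(e in A) ((src e == k)%:R - (tgt e == k)%:R) =
    (k == s)%:R - (k == j)%:R :> R.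
Proof.
move=> [p [up _ wp ->]] k.
rewrite (eq_bigl (mem p)) => [|e]; last by rewrite inE.
rewrite -big_uniq //= (eq_sym k s) (eq_sym k j).
elim: p {up} s wp => [|e p IHp] i /=.
  by move=> /eqP->; rewrite big_nil subrr.
by case/andP=> /eqP <- /IHp; rewrite big_cons => ->; ring.
Qed.

(** If the trail already uses [e], the new trail is its part up to [e]; this is
    why only an inclusion of edge sets is obtained. *)
Lemma extend_trail e A : avail e -> trail_to (src e) A ->
  exists2 B, trail_to (tgt e) B & B \subset e |: A.
Proof.
move=> ae [p [up ap wp ->]].
have [ep|ep] := boolP (e \in p); last first.
  exists [set e' in rcons p e].
    exists (rcons p e); split=> //; first by rewrite rcons_uniq ep.
      by rewrite all_rcons ae.
    by rewrite walk_rcons.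
  by apply/fintype.subsetP => e'; rewrite !inE mem_rcons inE.
case/splitPr: ep up ap wp => p1 p2 up ap /walk_cat[k w1 /= /andP[/eqP ek _]].
have sub : {subset rcons p1 e <= p1 ++ e :: p2}.
  by move=> e'; rewrite -cat_rcons mem_cat => ->.
exists [set e' in rcons p1 e].
  exists (rcons p1 e); split=> //.
  - by move: up; rewrite -cat_rcons cat_uniq => /andP[].
  - by apply/allP => e' /sub; apply: (allP ap).
  - by rewrite walk_rcons ek.
by apply/fintype.subsetP => e'; rewrite !inE => /sub ->; rewrite orbT.
Qed.

(** [D] is the distance from [s], with a large default at unreachable nodes. *)
Lemma shortest_trail_potential : (forall e, 0 <= cost e) ->
  exists D : N -> R,
    [/\ D s <= 0,
        forall e, avail e -> D (tgt e) <= D (src e) + cost e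
      & forall j A, trail_to j A ->
          exists2 B, trail_to j B & D j = \sum_(e in B) cost e].
Proof.
move=> cost_ge0.
(* The default value bounds the cost of every trail, so the edge inequality
   also holds when the source of the edge is unreachable. *)
pose D j := \big[Num.min/(\sum_e cost e)]_(A : {set E} | `[< trail_to j A >])
  \sum_(e in A) cost e.
have D_le j A : trail_to j A -> D j <= \sum_(e in A) cost e.
  by move=> jA; apply: bigmin_le_cond; apply/asboolP.
have sub_le (A B : {set E}) : A \subset B ->
    \sum_(e in A) cost e <= \sum_(e in B) cost e.
  move=> AB; rewrite [leRHS](big_setID A) /= (finset.setIidPr AB) lerDl.
  by rewrite sumr_ge0.
have total_ge (A : {set E}) : \sum_(e in A) cost e <= \sum_e cost e.
  have := sub_le _ _ (finset.subsetT A).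
  by rewrite [leRHS](eq_bigl xpredT) // => e; rewrite inE.
exists D; split.
- have /D_le : trail_to s (finset.set0 : {set E}).
    by exists [::]; split=> //=; apply/finset.setP => e; rewrite !inE.
  by rewrite big_set0.
- move=> e ae; rewrite -lerBlDr; apply: le_bigmin.
    rewrite lerBlDr (le_trans (bigmin_le_id _ _ _ _)) // lerDl //.
  move=> A /asboolP jA; rewrite lerBlDr.
  have [B /D_le DB BA] := extend_trail ae jA.
  apply: (le_trans DB); apply: (le_trans (sub_le _ _ BA)).
  have [eA|eA] := boolP (e \in A); last by rewrite big_setU1 //= addrC.
  have -> : e |: A = A by apply/finset.setUidPr; rewrite finset.sub1set.
  by rewrite lerDl.
move=> j A jA.
have jA' : [pred A | `[< trail_to j A >]] A by exact/asboolP.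
have [B /asboolP jB Bmin] :=
  arg_minP (fun A : {set E} => \sum_(e in A) cost e) jA'.
exists B => //; apply/le_anti.
rewrite D_le //=; apply: le_bigmin => //; exact: total_ge.
Qed.

End Trails.

(** * The follower problem and its dual *)

Lemma sum_mul_indicator (R : pzSemiRingType) (N : finType) (F : N -> R) k :
  \sum_i F i * (i == k)%:R = F k.
Proof.
rewrite (bigD1 k) //= eqxx mulr1 big1 ?addr0 // => i.
by move=> /negbTE ->; rewrite mulr0.
Qed.

Section Follower.
Variables (R : realType) (I : transit R) (r : trip I).
Implicit Types (z : design I) (f : flow r) (w : dual_point I).

(** The follower moves in one multigraph that has both the bus links and the
    shuttle arcs as edges; a link and an arc may have the same endpoints. *)
Definition edge : finType := (link I + Defs.arc r)%type.

Definition edge_src (e : edge) : stop I :=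
  match e with inl a => val a.1 | inr a => (val a).1 end.

Definition edge_tgt (e : edge) : stop I :=
  match e with inl a => val a.2 | inr a => (val a).2 end.

Definition edge_cost (e : edge) : R :=
  match e with inl a => tau a | inr a => gamma (val a).1 (val a).2 end.

Definition edge_open z (e : edge) : bool :=
  if e is inl a then z a else true.

Definition edge_flow f (e : edge) : bool :=
  match e with inl a => f.1 a | inr a => f.2 a end.

Definition flow_of_set (A : {set edge}) : flow r :=
  ([ffun a => inl a \in A], [ffun a => inr a \in A]).

Lemma edge_flow_of_set A e : edge_flow (flow_of_set A) e = (e \in A).
Proof. by case: e => a; rewrite /= ffunE. Qed.

Lemma net_outflowE f i :
  net_outflow f i = \sum_(e : edge)
    (edge_flow f e)%:R * ((edge_src e == i)%:R - (edge_tgt e == i)%:R).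
Proof.
rewrite /net_outflow big_sumType /= opprD addrACA.
by congr (_ + _); rewrite big_mkcond [X in _ - X]big_mkcond -sumrB;
  apply: eq_bigr => a _; do 2!case: ifP => _ /=; ring.
Qed.

Lemma follower_costE f :
  follower_cost f = \sum_(e : edge) (edge_flow f e)%:R * edge_cost e.
Proof.
rewrite /follower_cost big_sumType /=.
by congr (_ + _); apply: eq_bigr => a _; rewrite mulrC.
Qed.

Lemma tau_ge0 (a : link I) : 0 <= tau a.
Proof.
case/andP: (theta_01 I) => t0 _.
by rewrite mulr_ge0 // addr_ge0 ?time_ge0 ?wait_ge0.
Qed.

Lemma gamma_ge0 (i j : stop I) : 0 <= gamma i j.
Proof.
rewrite /gamma; case: ifP => _; last exact/ltW/bigM_gt0.
case/andP: (theta_01 I) => t0 t1.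
have := shuttle_cost_ge0 I; have := dist_ge0 i j; have := time_ge0 i j.
by move=> ? ? ?; rewrite addr_ge0 ?mulr_ge0 ?subr_ge0 // invr_ge0.
Qed.

Lemma edge_cost_ge0 e : 0 <= edge_cost e.
Proof. by case: e => a; [exact: tau_ge0|exact: gamma_ge0]. Qed.

Lemma follower_cost_ge0 f : 0 <= follower_cost f.
Proof.
by rewrite follower_costE sumr_ge0 // => e _; rewrite mulr_ge0 ?edge_cost_ge0.
Qed.

Lemma trail_feasible z A :
  trail_to edge_src edge_tgt (edge_open z) (orig r) (dest r) A ->
  follower_feasible z (flow_of_set A) /\
  follower_cost (flow_of_set A) = \sum_(e in A) edge_cost e.
Proof.
move=> trA; split; last first.
  rewrite follower_costE [RHS]big_mkcond; apply: eq_bigr => e _.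
  by rewrite edge_flow_of_set; case: ifP => _; rewrite ?mul1r ?mul0r.
split=> [i|a].
  rewrite net_outflowE -(trail_divergence R trA i) [RHS]big_mkcond.
  apply: eq_bigr => e _.
  by rewrite edge_flow_of_set; case: ifP => _; rewrite ?mul1r ?mul0r.
case: trA => p [_ op _ ->]; rewrite ffunE inE.
by case: (boolP (inl a \in p)) => // /(allP op) /= ->.
Qed.

(** The direct shuttle ride keeps the follower problem feasible. *)
Lemma direct_trail z :
  exists A, trail_to edge_src edge_tgt (edge_open z) (orig r) (dest r) A.
Proof.
have od : (orig r, dest r) \in arcs r by rewrite !inE eqxx orbT.
pose e : edge := inr (Sub (orig r, dest r) od).
by exists [set e' in [:: e]], [:: e]; split=> //=; rewrite !eqxx.
Qed.

Lemma SP_le_cost z f : follower_feasible z f -> SP r z <= follower_cost f.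
Proof.
move=> zf; apply: ge_inf; last by exists f.
by exists 0 => _ [g _ <-]; exact: follower_cost_ge0.
Qed.

Lemma le_SP z (m : R) :
  (forall f, follower_feasible z f -> m <= follower_cost f) -> m <= SP r z.
Proof.
move=> mP; apply: lb_le_inf; last by move=> _ [f /mP mf <-].
have [A /trail_feasible[feasA _]] := direct_trail z.
by exists (follower_cost (flow_of_set A)), (flow_of_set A).
Qed.

Lemma SP_ge0 z : 0 <= SP r z.
Proof. by apply: le_SP => f _; exact: follower_cost_ge0. Qed.

(** A flow that fits in [z] also fits in [z']. *)
Lemma SP_antitone z z' : (forall a, (z a <= z' a)%N) -> SP r z' <= SP r z.
Proof.
move=> zz'; apply: le_SP => f [cons cap]; apply: SP_le_cost; split=> // a.
exact: leq_trans (cap a) (zz' a).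
Qed.

(** Flow conservation turns the difference of potentials between origin and
    destination into the sum over the used edges of the potential drops, which
    the dual constraints bound by the edge costs, plus [v] on the used links;
    these are open, so [z] charges their [v] in the dual objective. *)
Lemma weak_duality z w : dual_feasible r w -> dual_objective r z w <= SP r z.
Proof.
case=> [wlink warc u_ge0 v_ge0]; apply: le_SP => f [cons cap].
rewrite /dual_objective.
have -> : w.1 (orig r) - w.1 (dest r) =
    \sum_(e : edge) (edge_flow f e)%:R * (w.1 (edge_src e) - w.1 (edge_tgt e)).
  transitivity (\sum_i (w.1 i : R) * net_outflow f i).
    rewrite -(sum_mul_indicator (w.1 : _ -> R) (orig r)).
    rewrite -(sum_mul_indicator (w.1 : _ -> R) (dest r)) -sumrB.
    by apply: eq_bigr => i _; rewrite cons mulrBr.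
  under eq_bigr do rewrite net_outflowE mulr_sumr.
  rewrite exchange_big /=; apply: eq_bigr => e _.
  rewrite -(sum_mul_indicator (w.1 : _ -> R) (edge_src e)).
  rewrite -(sum_mul_indicator (w.1 : _ -> R) (edge_tgt e)) -sumrB mulr_sumr.
  by apply: eq_bigr => i _; rewrite ![i == _]eq_sym; ring.
rewrite follower_costE lerBlDr !big_sumType /= addrAC lerD //.
  rewrite -big_split ler_sum //= => a _.
  have := wlink a; have := v_ge0 a; have := cap a.
  by case: (f.1 a); case: (z a) => //= _ ? ?; lra.
rewrite ler_sum // => a _; rewrite ler_wpM2l // warc //.
by case: a => -[i j].
Qed.

(** The potential is minus the distance from the origin in the graph of open
    links, shifted to be nonnegative. Closed links may violate the distance
    inequality; their [v] absorbs the excess, at no cost in the objective. *)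
Lemma strong_duality z :
  exists2 w, dual_feasible r w & dual_objective r z w = SP r z.
Proof.
have [D [D_orig D_edge D_trail]] := shortest_trail_potential
  edge_src edge_tgt (edge_open z) (orig r) edge_cost_ge0.
pose B := \sum_i `|D i|.
have D_le i : D i <= B.
  rewrite /B (bigD1 i) //= (le_trans (ler_norm _)) // lerDl.
  by rewrite sumr_ge0.
pose slack (a : link I) : R := D (val a.2) - D (val a.1) - tau a.
pose w : dual_point I :=
  ([ffun i => B - D i], [ffun a => if z a then 0 else Num.max 0 (slack a)]).
have feas : dual_feasible r w.
  split=> [a|i j ij|i|a]; rewrite /= !ffunE.
  - case: ifP => za; first by have := D_edge (inl a) za; rewrite /=; lra.
    have : slack a <= Num.max 0 (slack a) by rewrite le_max lexx orbT.
    by rewrite /slack; lra.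
  - by have := D_edge (inr (Sub (i, j) ij)) isT; rewrite /=; lra.
  - by rewrite subr_ge0.
  - by case: ifP => // _; rewrite le_max lexx.
exists w => //; apply/le_anti; rewrite weak_duality //=.
rewrite /dual_objective /= !ffunE big1 => [|a _]; last first.
  by rewrite ffunE; case: (z a); rewrite ?mulr0 ?mul0r.
have [A0 trA0] := direct_trail z.
have [A trA DA] := D_trail _ _ trA0.
have [/SP_le_cost + costA] := trail_feasible trA.
by rewrite costA -DA; move: D_orig; lra.
Qed.

Lemma dual_optimal_value z w :
  dual_optimal_vertex r z w -> dual_objective r z w = SP r z.
Proof.
case=> [[feas _] opt]; apply/le_anti; rewrite weak_duality //=.
by have [w' /opt + <-] := strong_duality z.
Qed.

(** The indices stand for the constraints of the dual subproblem: one for each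
    edge, one for the sign of each [u] and one for the sign of each [v]. *)
Definition dual_index : finType := (edge + stop I + link I)%type.

Definition dual_lhs (k : dual_index) w : R :=
  match k with
  | inl (inl (inl a)) => w.1 (val a.1) - w.1 (val a.2) - w.2 a
  | inl (inl (inr a)) => w.1 (val a).1 - w.1 (val a).2
  | inl (inr i) => - w.1 i
  | inr a => - w.2 a
  end.

Definition dual_rhs (k : dual_index) : R :=
  if k is inl (inl e) then edge_cost e else 0.

Lemma dual_feasibleE : dual_feasible r = polyhedron dual_lhs dual_rhs.
Proof.
apply/seteqP; split=> w.
  case=> wlink warc u_ge0 v_ge0 [[[a|[[i j] ij]]|i]|a] /=.
  - exact: wlink.
  - exact: warc.
  - by rewrite oppr_le0.
  - by rewrite oppr_le0.
move=> Pw; split=> [a|i j ij|i|a].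
- exact: (Pw (inl (inl (inl a)))).
- exact: (Pw (inl (inl (inr (Sub (i, j) ij))))).
- by have := Pw (inl (inr i)); rewrite /= oppr_le0.
- by have := Pw (inr a); rewrite /= oppr_le0.
Qed.

Lemma dual_vertex_exists z : exists w, dual_optimal_vertex r z w.
Proof.
have [w0 feas0 opt0] := strong_duality z.
rewrite /dual_optimal_vertex dual_feasibleE in feas0 *.
apply: (optimal_extreme_point _ _ _ feas0).
- move=> [[[a|a]|i]|a] t u v; rewrite /= !ffunE /= /GRing.scale /=; ring.
- move=> t u v; rewrite /dual_objective /= !ffunE /= /GRing.scale /=.
  under eq_bigr do rewrite !ffunE /= mulrDr.
  rewrite big_split /= mulrBr mulr_sumr.
  under eq_bigr do rewrite mulrCA.
  ring.
- move=> [u v] e0; congr pair; apply/ffunP => i; rewrite ffunE.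
    by have /eqP := e0 (inl (inr i)); rewrite /= oppr_eq0 => /eqP.
  by have /eqP := e0 (inr i); rewrite /= oppr_eq0 => /eqP.
- by move=> w; rewrite -dual_feasibleE opt0; exact: weak_duality.
Qed.

End Follower.

(** * The master problem *)

Section Master.
Variables (R : realType) (I : transit R).
Variables (C : chooser I -> R -> bool) (Mbar : chooser I -> R) (eps : R).
Implicit Types (z : design I) (q : master_point I) (F : set (master_point I)).

Definition balanced z : Prop :=
  forall h : hub I, (\sum_(l : hub I) z (h, l) = \sum_(l : hub I) z (l, h))%N.

(** The point of the bilevel problem, in the variables of the master problem,
    that is determined by the design [z]. *)
Definition bilevel_point z : master_point I :=
  MasterPoint z [ffun r => C r (SP (val r) z)]
    (fun r => (C r (SP (val r) z))%:R * SP (val r) z) (fun r => SP r z).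

(** The form that all master problems of a run share: for a fixed design and
    choice vector, the cuts are lower bounds [L] on the variables d. *)
Definition fiberwise_bounded F : Prop :=
  exists (L : design I -> trip I -> R)
         (K : design I -> {ffun chooser I -> bool} -> Prop),
    (forall z r, 0 <= L z r) /\
    forall q, F q <-> [/\ initial_master Mbar q,
                          forall r, L (mz q) r <= md q r
                        & K (mz q) (mdelta q)].

(** For a fixed pair (z, delta) the best choice is to take every d equal to its
    lower bound, since no coefficient of the objective is negative and smaller
    values of d only relax the constraints linking nu to d. *)
Lemma master_optimum_exists F :
  fiberwise_bounded F -> (exists q, F q) -> exists q, master_optimal F q.
Proof.
move=> [L [K [L_ge0 FE]]] [q0 Fq0].
pose best (zd : design I * {ffun chooser I -> bool}) := MasterPoint zd.1 zd.2
  (fun r => (zd.2 r)%:R * L zd.1 (val r)) (L zd.1).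
have bestP q : F q -> F (best (mz q, mdelta q)) /\
    master_objective (best (mz q, mdelta q)) <= master_objective q.
  move=> /FE[[bal d_ge0 lin] Ld Kq]; split.
    apply/FE; split=> //; split=> //= r.
    have [] := lin r; have := Ld (val r); have := L_ge0 (mz q) (val r).
    by case: (mdelta q r) => /= ? ? ? ? ? ?; split; lra.
  rewrite /master_objective /= !lerD //; apply: ler_sum => r _.
    by rewrite ler_wpM2l.
  rewrite ler_wpM2l //; have [] := lin r; have := Ld (val r).
  by case: (mdelta q r) => /= ? ? ? ? ?; lra.
have P0 : [pred zd | `[< F (best zd) >]] (mz q0, mdelta q0).
  by apply/asboolP; case: (bestP _ Fq0).
have [zd /asboolP Fzd zd_min] :=
  arg_minP (fun zd => master_objective (best zd)) P0.
exists (best zd); split=> // q Fq; have [Fb le_b] := bestP _ Fq.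
by apply: le_trans le_b; apply: zd_min; apply/asboolP.
Qed.

Lemma choice_cut_fiber q q1 q2 r : mz q1 = mz q2 -> mdelta q1 = mdelta q2 ->
  choice_cut C q r q1 -> choice_cut C q r q2.
Proof.
rewrite /choice_cut => ez ed.
by case: (mdelta q r); case: (C r _);
  rewrite // /rejection_cut /adoption_cut /= ez ed.
Qed.

(** A wrong choice at [q] triggers a cut that [q'] would violate: at the design
    of [q] itself the sum in either cut vanishes. *)
Lemma choice_cut_exact q r q' :
  mz q' = mz q -> mdelta q' = mdelta q -> choice_cut C q r q' ->
  mdelta q r = C r (SP (val r) (mz q)).
Proof.
rewrite /choice_cut => ez ed.
case edr: (mdelta q r); case: (C r _) => //=.
  rewrite /rejection_cut /= ez ed edr big1 ?ler10 // => a /negbTE ->.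
  by [].
rewrite /adoption_cut /= ez ed edr big1 ?addr0 ?ler10 // => a ->.
by rewrite subrr.
Qed.

Lemma UBhat_le_objective q :
  initial_master Mbar q -> (forall r, SP r (mz q) <= md q r) ->
  (forall r, mdelta q r = C r (SP (val r) (mz q))) ->
  UBhat C (mz q) <= master_objective q.
Proof.
move=> [_ _ lin] dSP dC; rewrite /UBhat /master_objective !lerD //.
  by apply: ler_sum => r _; rewrite ler_wpM2l.
apply: ler_sum => r _; rewrite -mulrA ler_wpM2l // -dC.
have [] := lin r; have := dSP (val r).
by case: (mdelta q r) => /= ? ? ? ? ?; lra.
Qed.

Lemma iteration_monotone s s' : iteration C s s' ->
  (UB s' <= UB s)%E /\ (master s' `<=` master s)%classic.
Proof.
move=> [q [w [_ _ ->]]] /=; split; last by move=> q' [[]].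
by case: ifP => // /ltW.
Qed.

Lemma bilevel_point_initial z :
  (forall r z, SP (val r) z <= Mbar r) -> balanced z ->
  initial_master Mbar (bilevel_point z).
Proof.
move=> Mbar_ge bal; split=> //= r; first exact: SP_ge0.
have := Mbar_ge r z; have := SP_ge0 (val r) z; rewrite !ffunE.
by case: (C r _) => /= ? ?; split; lra.
Qed.

(** If [z] opens no link that is closed in [mz q], then its SP is at least that
    of [mz q], so a rider who rejects at [mz q] also rejects at [z]. Otherwise
    the sum in the rejection cut is at least 1 at [z]. Adoption cuts are
    symmetric. *)
Lemma bilevel_point_choice_cut q r z :
  (forall r, anti_monotone (C r)) -> choice_cut C q r (bilevel_point z).
Proof.
move=> C_anti; rewrite /choice_cut.
have sum_ge1 (P : pred (link I)) (b : link I -> bool) a : P a -> b a ->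
    1 <= \sum_(a | P a) (b a)%:R :> R.
  by move=> Pa ba; rewrite (bigD1 a) //= ba lerDl sumr_ge0.
case: (mdelta q r); case Cq: (C r (SP (val r) (mz q))) => //.
  rewrite /rejection_cut /= ffunE; case Cz: (C r (SP (val r) z)); last first.
    by rewrite /= sumr_ge0.
  have [[a /andP[qa za]]|none] := pselect (exists a, ~~ mz q a && z a).
    exact: sum_ge1 za.
  have /(C_anti r) : SP (val r) (mz q) <= SP (val r) z.
    apply: SP_antitone => a; case za: (z a) => //.
    by case qa: (mz q a) => //; case: none; exists a; rewrite qa za.
  by rewrite Cz Cq.
rewrite /adoption_cut /= ffunE.
have negE a : 1 - (z a)%:R = (~~ z a)%:R :> R.
  by case: (z a); rewrite ?subrr ?subr0.
under eq_bigr do rewrite negE.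
case Cz: (C r (SP (val r) z)); first by rewrite lerDr sumr_ge0.
rewrite addr0.
have [[a /andP[qa za]]|none] := pselect (exists a, mz q a && ~~ z a).
  exact: sum_ge1 za.
have /(C_anti r) : SP (val r) z <= SP (val r) (mz q).
  apply: SP_antitone => a; case qa: (mz q a) => //.
  by case za: (z a) => //; case: none; exists a; rewrite qa za.
by rewrite Cz Cq.
Qed.

(** An optimality cut raises the bounds [L] to the dual objective of the new
    vertex, and a choice cut constrains only the pair (z, delta). *)
Lemma reachable_master s :
  (forall r z, SP (val r) z <= Mbar r) -> (forall r, anti_monotone (C r)) ->
  reachable C Mbar eps s ->
  fiberwise_bounded (master s) /\
  forall z, balanced z -> master s (bilevel_point z).
Proof.
move=> Mbar_ge C_anti; elim=> [|{}s _ _ [fb valid] _ [q [w [_ wopt ->]]]].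
  split=> [|z bal]; last exact: bilevel_point_initial.
  exists (fun _ _ => 0), (fun _ _ => True); split=> // q.
  by split=> [init|[]//]; split=> //; case: init.
split=> /= [|z bal]; last first.
  split; last by move=> r; exact: bilevel_point_choice_cut.
  split; first exact: valid.
  by move=> r; apply: weak_duality; case: (wopt r) => -[].
have [L [K [L_ge0 FE]]] := fb.
(* A choice cut does not depend on nu and d, so their value here is
   immaterial. *)
exists (fun z r => Num.max (L z r) (dual_objective r z (w r))),
  (fun z d => K z d /\ forall r, choice_cut C q r
     (MasterPoint z d (fun=> 0) (fun=> 0))).
split=> [z r|q']; first by rewrite le_max L_ge0.
split=> [[[/FE[init Ld Kq] oc] cc]|[init Ld [Kq cc]]].
  split=> // [r|]; first by rewrite ge_max Ld /=; exact: oc.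
  by split=> // r; exact: choice_cut_fiber (cc r).
split=> [|r]; last exact: choice_cut_fiber (cc r).
split=> [|r]; last by have := Ld r; rewrite ge_max => /andP[].
by apply/FE; split=> // r; have := Ld r; rewrite ge_max => /andP[].
Qed.

Lemma iteration_exists s :
  (forall r z, SP (val r) z <= Mbar r) -> (forall r, anti_monotone (C r)) ->
  reachable C Mbar eps s -> exists s', iteration C s s'.
Proof.
move=> Mbar_ge C_anti reach.
have [fb valid] := reachable_master Mbar_ge C_anti reach.
have [|q qopt] := master_optimum_exists fb.
  (* Opening no link is a balanced design. *)
  exists (bilevel_point [ffun=> false]); apply: valid => h.
  by apply: eq_bigr => l _; rewrite !ffunE.
have [w wopt] := choice (fun r => dual_vertex_exists r (mz q)).
by eexists; exists q, w; split.
Qed.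

(** * Termination *)

Lemma repeated_value (T : finType) (key : nat -> T) :
  exists i j, (i < j)%N /\ key i = key j.
Proof.
have /injectivePn[x [y xy kxy]] :
    ~~ injectiveb (fun n : 'I_#|T|.+1 => key n).
  by apply/injectiveP => /leq_card; rewrite card_ord ltnn.
have [lt|lt|/val_inj eq] := ltngtP x y; first by exists x, y.
  by exists y, x.
by rewrite eq eqxx in xy.
Qed.

Lemma execution_stops (s : nat -> state I) :
  0 <= eps -> execution C Mbar eps s -> exists k, stopped eps (s k).
Proof.
move=> eps_ge0 [s0 step]; apply: contrapT => never.
have {}step k : iteration C (s k) (s k.+1).
  by apply: step; apply/negP => stop_k; apply: never; exists k.
have [qw qwP] := choice step.
have [i [j [ij]]] := repeated_value (fun k => (mz (qw k), mdelta (qw k))).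
case=> ez ed.
have UB_le m n : (m <= n)%N -> (UB (s n) <= UB (s m))%E.
  move=> /subnK <-; elim: (n - m)%N => // d IHd.
  apply: le_trans IHd; rewrite addSn.
  by case: (iteration_monotone (step (d + m)%N)).
have master_sub m n : (m <= n)%N -> (master (s n) `<=` master (s m))%classic.
  move=> /subnK <-; elim: (n - m)%N => // d IHd.
  apply: subset_trans IHd; rewrite addSn.
  by case: (iteration_monotone (step (d + m)%N)).
have [wi [_ wiopt si]] := qwP i; have [wj [[qj_in _] _ sj]] := qwP j.
have qj_init : initial_master Mbar (qw j).
  have := master_sub 0%N j isT _ qj_in; by rewrite s0.
have : master (s i.+1) (qw j) by apply: (master_sub _ j).
rewrite si => -[[_ ocut] ccut].
apply: never; exists j.+1; rewrite /stopped.
have UBi : (UB (s i.+1) <= (UBhat C (mz (qw i)))%:E)%E.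
  by rewrite si /=; case: ltP.
apply: (le_trans (UB_le i.+1 j.+1 _)); first exact: ltnW.
apply: (le_trans UBi); rewrite sj /= -EFinD lee_fin -[leLHS]addr0 lerD // ez.
apply: UBhat_le_objective => // r; last first.
  have := choice_cut_exact (esym ez) (esym ed) (ccut r).
  by rewrite ez ed.
by rewrite -ez -(dual_optimal_value (wiopt r)) ez; exact: ocut.
Qed.

End Master.

(* Every execution meets the stopping condition after finitely many iterations,
   and no execution blocks before: as long as the stopping condition fails, the
   optimization problems of the next iteration have optimal solutions. *)
Theorem proposition8 (R : realType) (I : transit R)
    (C : chooser I -> R -> bool) (Mbar : chooser I -> R) (eps : R)
    (Mbar_ge : forall (r : chooser I) (z : design I), SP (val r) z <= Mbar r)
    (eps_ge0 : 0 <= eps)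
    (C_anti : forall r : chooser I, anti_monotone (C r)) :
  (forall s : nat -> state I, execution C Mbar eps s ->
     exists k : nat, stopped eps (s k)) /\
  (forall s : state I, reachable C Mbar eps s -> ~~ stopped eps s ->
     exists s' : state I, iteration C s s').
Proof.
split=> [s|s reach _]; first exact: execution_stops.
exact: iteration_exists reach.
Qed.
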